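(* Let $\Omega$ be a set, $\sigma:\Omega\to\Omega$ an invertible map, and let $\{\mathcal{L}_{\omega,\epsilon}:\mathcal{B}_\omega\to\mathcal{B}_{\sigma\omega}\}_{\omega\in\Omega,\,0\le\epsilon\le\epsilon_0}$ be a family of linear operators between normed vector spaces satisfying assumptions (P1)–(P8) listed in the context. Let $\omega\in\Omega$. (a) If there is some $\epsilon_0>0$ such that $\Delta_{\omega,\epsilon}=0$ for all $\epsilon\le\epsilon_0$, then $\lambda_{\omega,0}=\lambda_{\omega,\epsilon}$ for all $\epsilon\le \epsilon_0$. (b) If $\Delta_{\omega,\epsilon}>0$ for all $\epsilon>0$ and, in addition, (P9) holds, then $$\lim_{\epsilon\to0}\frac{\lambda_{\omega,0}-\lambda_{\omega,\epsilon}}{\Delta_{\omega,\epsilon}}=1-\sum_{k=0}^{\infty}\bigl(\lambda^{k+1}_{\sigma^{-(k+1)}\omega,0}\bigr)^{-1}q^{(k)}_{\omega,0}.$$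
   Context: $\{(\mathcal{B}_\omega,\|\cdot\|_{\mathcal{B}_\omega})\}_{\omega\in\Omega}$ is a family of normed vector spaces with duals $\mathcal{B}_\omega^*$. No measurability is assumed. For a family of operators $A_\omega:\mathcal{B}_\omega\to\mathcal{B}_{\sigma\omega}$ write $A_\omega^n=A_{\sigma^{n-1}\omega}\circ\cdots\circ A_{\sigma\omega}\circ A_\omega$ ($A^0_\omega=\mathrm{id}$), and for scalars $\lambda_{\omega,\epsilon}^n=\lambda_{\omega,\epsilon}\lambda_{\sigma\omega,\epsilon}\cdots\lambda_{\sigma^{n-1}\omega,\epsilon}$. Define $$\Delta_{\omega,\epsilon}:=\nu_{\sigma\omega,0}\bigl((\mathcal{L}_{\omega,0}-\mathcal{L}_{\omega,\epsilon})(\varphi_{\omega,0})\bigr),\qquad \eta_{\omega,\epsilon}:=\|\nu_{\sigma\omega,0}(\mathcal{L}_{\omega,0}-\mathcal{L}_{\omega,\epsilon})\|_{\mathcal{B}_\omega^*},$$ with $\nu_{\omega,\epsilon},\varphi_{\omega,\epsilon}$ as in (P2). (P1) There is $C_1:\Omega\to\mathbb{R}_+$ with $\sup_{\epsilon\ge0}\|\mathcal{L}_{\omega,\epsilon}(f)\|_{\mathcal{B}_{\sigma\omega}}\le C_1(\omega)\|f\|_{\mathcal{B}_\omega}$ for $f\in\mathcal{B}_\omega$. (P2) For each $\omega\in\Omega$ and $\epsilon\ge0$ there are $\nu_{\omega,\epsilon}\in\mathcal{B}_\omega^*$, $\lambda_{\omega,\epsilon}\in\mathbb{C}\setminus\{0\}$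 and $\varphi_{\omega,\epsilon}\in\mathcal{B}_\omega$ with $\mathcal{L}_{\omega,\epsilon}(\varphi_{\omega,\epsilon})=\lambda_{\omega,\epsilon}\varphi_{\sigma\omega,\epsilon}$ and $\nu_{\sigma\omega,\epsilon}(\mathcal{L}_{\omega,\epsilon}(f))=\lambda_{\omega,\epsilon}\nu_{\omega,\epsilon}(f)$ for all $f\in\mathcal{B}_\omega$; furthermore $\nu_{\omega,0}(\varphi_{\omega,\epsilon})=1$. (P3) There is an operator $Q_{\omega,\epsilon}:\mathcal{B}_\omega\to\mathcal{B}_{\sigma\omega}$ such that $\lambda_{\omega,\epsilon}^{-1}\mathcal{L}_{\omega,\epsilon}(f)=\nu_{\omega,\epsilon}(f)\varphi_{\sigma\omega,\epsilon}+Q_{\omega,\epsilon}(f)$ for each $f\in\mathcal{B}_\omega$, and $Q_{\omega,\epsilon}(\varphi_{\omega,\epsilon})=0$, $\nu_{\sigma\omega,\epsilon}(Q_{\omega,\epsilon}(f))=0$. (P4) There is $C_2:\Omega\to\mathbb{R}_+$ with $\sup_{\epsilon\ge0}\|\varphi_{\omega,\epsilon}\|_{\mathcal{B}_\omega}=C_2(\omega)<\infty$. (P5) For each $\omega\in\Omega$, $\lim_{\epsilon\to0}\eta_{\omega,\epsilon}=0$. (P6) For each $\omega$ such that $\Delta_{\omega,\epsilon}>0$ for every $\epsilon>0$, $\limsup_{\epsilon\to0}\eta_{\omega,\epsilon}/\Delta_{\omega,\epsilon}=:C_3(\omega)<\infty$. Moreover, given $\omega$, if there is $\epsilon_0>0$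 such that $\Delta_{\omega,\epsilon}=0$ for each $\epsilon\le\epsilon_0$, then also $\eta_{\omega,\epsilon}=0$ for each $\epsilon\le\epsilon_0$. (P7) For each $\omega\in\Omega$, $\lim_{\epsilon\to0}\nu_{\omega,\epsilon}(\varphi_{\omega,0})=1$. (P8) For each $\omega$ with $\Delta_{\omega,\epsilon}>0$ for all $\epsilon>0$, $$\lim_{n\to\infty}\limsup_{\epsilon\to0}\Bigl|\Delta_{\omega,\epsilon}^{-1}\,\nu_{\sigma\omega,0}\bigl((\mathcal{L}_{\omega,0}-\mathcal{L}_{\omega,\epsilon})(Q^n_{\sigma^{-n}\omega,\epsilon}\varphi_{\sigma^{-n}\omega,0})\bigr)\Bigr|=0.$$ (P9) For each $\omega$ with $\Delta_{\omega,\epsilon}>0$ for all $\epsilon>0$, the limit $$q^{(k)}_{\omega,0}:=\lim_{\epsilon\to0}\frac{\nu_{\sigma\omega,0}\bigl((\mathcal{L}_{\omega,0}-\mathcal{L}_{\omega,\epsilon})(\mathcal{L}^k_{\sigma^{-k}\omega,\epsilon})(\mathcal{L}_{\sigma^{-(k+1)}\omega,0}-\mathcal{L}_{\sigma^{-(k+1)}\omega,\epsilon})(\varphi_{\sigma^{-(k+1)}\omega,0})\bigr)}{\nu_{\sigma\omega,0}\bigl((\mathcal{L}_{\omega,0}-\mathcal{L}_{\omega,\epsilon})(\varphi_{\omega,0})\bigr)}$$ exists for each $k\ge0$. *)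

(* Defs.v *)
(* MathComp-Analysis *)
From HB Require Import structures.
From mathcomp Require Import all_boot all_order all_algebra complex.
From mathcomp Require Import all_classical all_reals all_analysis.

Set Implicit Arguments.
Unset Strict Implicit.
Unset Printing Implicit Defensive.

Import Order.TTheory GRing.Theory Num.Theory.
Import numFieldNormedType.Exports.

Local Open Scope classical_set_scope.
Local Open Scope ring_scope.
Local Open Scope complex_scope.

(* In a normed module over R[i] the norm takes its values in R[i], as a complex
   number that is real and nonnegative; rnorm is this norm read in R. The
   scalars carry their topology and norm as R[i]^o. *)
Definition rnorm (R : realType) (V : normedModType R[i]) (x : V) : R :=
  complex.Re `|x|.

(* For unbounded f the real supremum is the junk value 0; the functionals whose
   dual norm is taken below are bounded by P1 and P2. *)
Definition dual_norm (R : realType) (V : normedModType R[i])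
    (f : V -> R[i]^o) : R :=
  sup [set rnorm (f x) | x in [set x : V | rnorm x <= 1]].

Section Iterates.
Variables (R : realType) (Omega : Type) (sigma tau : Omega -> Omega).
Variable B : Omega -> normedModType R[i].

(* The point sigma^n (sigma^-n w) is equal but not convertible to w, so elements
   of the fibre above the former are carried to the fibre above the latter. *)
Definition transport (w w' : Omega) (E : w = w') : B w -> B w' :=
  match E in _ = u return B w -> B u with erefl => id end.

Fixpoint iter_op (A : forall w, B w -> B (sigma w)) (n : nat) (w : Omega) :
    B w -> B (iter n sigma w) :=
  match n return B w -> B (iter n sigma w) with
  | 0%N => id
  | m.+1 => fun x => A (iter m sigma w) (iter_op A m x)
  end.

Lemma iter_cancel (tK : cancel tau sigma) (n : nat) :
  cancel (iter n tau) (iter n sigma).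
Proof.
by elim: n => [|n IHn] w //; rewrite iterSr iterS tK IHn.
Qed.

(* A^n_{sigma^-n w} : B_{sigma^-n w} -> B_w, where tau = sigma^-1. *)
Definition pull_op (tK : cancel tau sigma) (A : forall w, B w -> B (sigma w))
    (n : nat) (w : Omega) (x : B (iter n tau w)) : B w :=
  transport (iter_cancel tK n w) (iter_op A n x).

End Iterates.

Section Perturbation.
Variables (R : realType) (Omega : Type) (sigma tau : Omega -> Omega).
Variable tK : cancel tau sigma.
Variable B : Omega -> normedModType R[i].
(* The families are total in the parameter e : R; only 0 <= e <= ebar is ever
   constrained. *)
Variable ebar : R.
Variable L : forall w, R -> {linear B w -> B (sigma w)}.
Variable nu : forall w, R -> {linear B w -> R[i]^o}.
Variable lambda : Omega -> R -> R[i].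
Variable phi : forall w, R -> B w.
Variable Q : forall w, R -> {linear B w -> B (sigma w)}.

Definition Ldiff (w : Omega) (e : R) (x : B w) : B (sigma w) :=
  L w 0 x - L w e x.

Definition Delta (w : Omega) (e : R) : R[i] :=
  nu (sigma w) 0 (Ldiff e (phi w 0)).

Definition eta (w : Omega) (e : R) : R :=
  dual_norm (fun x : B w => nu (sigma w) 0 (Ldiff e x)).

(* In R[i], 0 < z means that z is real and positive. *)
Definition Delta_pos (w : Omega) : Prop :=
  forall e : R, 0 < e <= ebar -> 0 < Delta w e.

Definition lambda_iter (n : nat) (w : Omega) (e : R) : R[i] :=
  \prod_(i < n) lambda (iter i sigma w) e.

Definition q_ratio (w : Omega) (k : nat) (e : R) : R[i] :=
  nu (sigma w) 0
    (Ldiff e (pull_op tK (fun u => L u e)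
      (transport (tK (iter k tau w))
        (Ldiff e (phi (iter k.+1 tau w) 0)))))
  / Delta w e.

Definition q (w : Omega) (k : nat) : R[i]^o :=
  lim ((q_ratio w k e : R[i]^o) @[e --> 0^'+]).

Definition P1 : Prop :=
  exists C1 : Omega -> R, forall w, 0 <= C1 w /\
    forall f : B w,
      (ereal_sup [set (rnorm (L w e f))%:E | e in `[0%R, ebar]]
        <= (C1 w * rnorm f)%:E)%E.

Definition P2 : Prop :=
  forall w (e : R), 0 <= e <= ebar ->
  [/\ continuous (nu w e),
      lambda w e != 0,
      L w e (phi w e) = lambda w e *: phi (sigma w) e,
      forall f : B w, nu (sigma w) e (L w e f) = lambda w e * nu w e f
    & nu w 0 (phi w e) = 1].

Definition P3 : Prop :=
  forall w (e : R), 0 <= e <= ebar ->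
  [/\ forall f : B w, (lambda w e)^-1 *: L w e f
                      = nu w e f *: phi (sigma w) e + Q w e f,
      Q w e (phi w e) = 0
    & forall f : B w, nu (sigma w) e (Q w e f) = 0].

Definition P4 : Prop :=
  exists C2 : Omega -> R, forall w, 0 <= C2 w /\
    ereal_sup [set (rnorm (phi w e))%:E | e in `[0%R, ebar]] = (C2 w)%:E.

Definition P5 : Prop := forall w, eta w e @[e --> 0^'+] --> (0 : R).

(* Where the quotient is considered Delta is real, so that eta / Delta is
   eta / Re Delta. *)
Definition P6 : Prop :=
  (forall w, Delta_pos w ->
    (limf_esup (fun e => (eta w e / complex.Re (Delta w e))%:E) 0^'+ < +oo)%E)
  /\
  (forall w (e0 : R), 0 < e0 ->
    (forall e : R, 0 <= e <= ebar -> e <= e0 -> Delta w e = 0) ->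
    forall e : R, 0 <= e <= ebar -> e <= e0 -> eta w e = 0).

Definition P7 : Prop :=
  forall w, nu w e (phi w 0) @[e --> 0^'+] --> (1 : R[i]^o).

Definition P8 : Prop :=
  forall w, Delta_pos w ->
    limf_esup (fun e => (rnorm ((Delta w e)^-1 *
        nu (sigma w) 0
          (Ldiff e (pull_op tK (fun u => Q u e) (phi (iter n tau w) 0)))
        : R[i]^o))%:E) 0^'+
      @[n --> \oo] --> 0%E.

Definition P9 : Prop :=
  forall w, Delta_pos w -> forall k,
    cvg ((q_ratio w k e : R[i]^o) @[e --> 0^'+]).

End Perturbation.

(* Main.v *)
(* Since nu_{w,0}(phi_{w,e}) = 1, lambda_{w,0} - lambda_{w,e} equals
   nu_{sigma w,0}((L_{w,0} - L_{w,e}) phi_{w,e}), which is at most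
   eta_{w,e} C_2(w) in modulus; this gives (a) and lambda_{w,e} --> lambda_{w,0}.

   For (b), let x_n = (lambda^n_{sigma^-n w,0})^-1 L^n_{sigma^-n w,e} phi_{sigma^-n w,0}
   and let N_n be nu_{sigma w,0}((L_{w,0} - L_{w,e}) x_n) / Delta_{w,e}. The
   differences x_n - x_{n+1} telescope, so N_n = 1 - sum_{k<n} of the
   e-dependent terms of the series. The spectral decomposition (P3) gives instead
   N_n = r_n (v_n D + E_n), where D is the quotient under study, r_n and v_n
   tend to 1 with e, and E_n is the term controlled by (P8). Hence D stays within
   o(1) + 2 |E_n| of the n-th partial value S_n as e --> 0. As D does not depend
   on n, (S_n) is a Cauchy sequence, and D tends to its limit. *)

Require Import Defs.
From HB Require Import structures.
From mathcomp Require Import all_boot all_order all_algebra complex.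
From mathcomp Require Import all_classical all_reals all_analysis.
From mathcomp Require Import lra.

Set Implicit Arguments.
Unset Strict Implicit.
Unset Printing Implicit Defensive.

Import Order.TTheory GRing.Theory Num.Theory.
Import numFieldNormedType.Exports.

Local Open Scope classical_set_scope.
Local Open Scope ring_scope.
Local Open Scope complex_scope.

(** * Real-valued norms, limits and bounded functionals over complex scalars *)

Section ComplexNorm.
Variable R : realType.
Implicit Type V : normedModType R[i].

Lemma rnormE V (x : V) : (rnorm x)%:C = `|x|.
Proof. by rewrite /rnorm RRe_real. Qed.

Lemma rnorm_ge0 V (x : V) : 0 <= rnorm x.
Proof. by rewrite -lecR rnormE normr_ge0. Qed.

Lemma rnorm0 V : rnorm (0 : V) = 0.
Proof. by rewrite /rnorm normr0. Qed.

Lemma rnorm0_eq0 V (x : V) : rnorm x = 0 -> x = 0.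
Proof. by move=> x0; apply: normr0_eq0; rewrite -rnormE x0. Qed.

Lemma ler_rnormD V (x y : V) : rnorm (x + y) <= rnorm x + rnorm y.
Proof. by rewrite -lecR rmorphD /= !rnormE ler_normD. Qed.

Lemma rnormN V (x : V) : rnorm (- x) = rnorm x.
Proof. by rewrite /rnorm normrN. Qed.

Lemma ler_rnormB V (x y : V) : rnorm (x - y) <= rnorm x + rnorm y.
Proof. by rewrite (le_trans (ler_rnormD _ _))// rnormN. Qed.

Lemma rnormZ V (a : R[i]) (x : V) : rnorm (a *: x) = rnorm (a : R[i]^o) * rnorm x.
Proof. by apply: complexI; rewrite rmorphM /= !rnormE normrZ. Qed.

Lemma rnormM (a b : R[i]^o) : rnorm (a * b : R[i]^o) = rnorm a * rnorm b.
Proof. exact: rnormZ. Qed.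

Lemma rnorm_real (a : R) : 0 <= a -> rnorm (a%:C : R[i]^o) = a.
Proof. by move=> a0; apply: complexI; rewrite rnormE ger0_norm // lecR. Qed.

Lemma Re_le_rnorm (z : R[i]^o) : `|complex.Re z| <= rnorm z.
Proof. by rewrite /rnorm normc_def /= -sqrtr_sqr ler_wsqrtr // lerDl sqr_ge0. Qed.

Lemma Im_le_rnorm (z : R[i]^o) : `|complex.Im z| <= rnorm z.
Proof. by rewrite /rnorm normc_def /= -sqrtr_sqr ler_wsqrtr // lerDr sqr_ge0. Qed.

Lemma rnorm_le_ReIm (z : R[i]^o) :
  rnorm z <= `|complex.Re z| + `|complex.Im z|.
Proof.
rewrite /rnorm normc_def /= -[leRHS]ger0_norm ?addr_ge0 // -sqrtr_sqr.
rewrite ler_wsqrtr // sqrrD !real_normK ?num_real // lerD2r lerDl.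
by rewrite mulrn_wge0 // mulr_ge0.
Qed.

(** The radii in the topology of [V] are positive elements of [R[i]]; positivity there forces a
    radius to be real, so real radii suffice. *)
Lemma cvg_rnormP V (T : Type) (F : set_system T) (FF : Filter F)
    (f : T -> V) (l : V) :
  f x @[x --> F] --> l <->
  forall eps : R, 0 < eps -> \forall x \near F, rnorm (f x - l) <= eps.
Proof.
split=> [/cvgrPdist_le fl eps eps0|fl].
  have := fl eps%:C; rewrite ltcR => /(_ eps0); apply: filterS => x.
  by rewrite distrC -rnormE lecR.
apply/cvgrPdist_le => eps eps0.
have epsE : eps = (complex.Re eps)%:C by rewrite RRe_real // gtr0_real.
rewrite epsE ltcR in eps0 *.
by apply: filterS (fl _ eps0) => x; rewrite distrC -rnormE lecR.
Qed.

Lemma complex_cvg_ReIm (T : Type) (F : set_system T) (FF : Filter F)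
    (f : T -> R[i]^o) (a b : R) :
  complex.Re (f x) @[x --> F] --> a -> complex.Im (f x) @[x --> F] --> b ->
  f x @[x --> F] --> (a +i* b : R[i]^o).
Proof.
move=> /cvgrPdist_le fa /cvgrPdist_le fb; apply/cvg_rnormP => eps eps0.
have eps20 : 0 < eps / 2 by rewrite divr_gt0.
near=> x; rewrite (le_trans (rnorm_le_ReIm _)) // [leRHS]splitr lerD //.
  have : `|a - complex.Re (f x)| <= eps / 2 by near: x; exact: fa.
  by rewrite distrC; case: (f x).
have : `|b - complex.Im (f x)| <= eps / 2 by near: x; exact: fb.
by rewrite distrC; case: (f x).
Unshelve. all: by end_near. Qed.

(** Completeness of [R] applies to the real and imaginary parts, which are additive and bounded by
    [rnorm]. *)
Lemma complex_cauchy_cvgn (u : nat -> R[i]^o) :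
  (forall eps : R, 0 < eps -> exists N : nat, forall n, (N <= n)%N ->
    rnorm (u n - u N) <= eps) ->
  cvgn u.
Proof.
move=> u_cauchy.
have cvg_proj (p : R[i]^o -> R) :
    (forall x y, p (x - y) = p x - p y) -> (forall z, `|p z| <= rnorm z) ->
    cvgn (p \o u).
  move=> pB ple; apply/cauchy_cvgP/cauchy_exP => eps eps0.
  have eps20 : 0 < eps / 2 by rewrite divr_gt0.
  have [N uN] := u_cauchy _ eps20.
  exists (p (u N)); exists N => // n /= Nn.
  rewrite /ball /= distrC -pB (le_lt_trans (ple _)) // (le_lt_trans (uN n Nn)) //.
  by rewrite gtr_pMr // invf_lt1 // ltr1n.
have /cvg_ex [a Rea] := cvg_proj (@complex.Re R) ltac:(by move=> [? ?] [? ?])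
  Re_le_rnorm.
have /cvg_ex [b Imb] := cvg_proj (@complex.Im R) ltac:(by move=> [? ?] [? ?])
  Im_le_rnorm.
by apply/cvg_ex; exists (a +i* b); apply: complex_cvg_ReIm.
Qed.

(** Since [D] does not depend on [n], two values [S n] and [S N] can be compared through [D x] at
    one common point [x], which exists because [F] is proper. This makes [S] Cauchy, so its
    convergence is a conclusion and not an assumption. *)
Lemma cvg_uniform_approx (T : Type) (F : set_system T) (FF : ProperFilter F)
    (D : T -> R[i]^o) (S : nat -> R[i]^o) :
  (forall eps : R, 0 < eps ->
    \forall n \near \oo, \forall x \near F, rnorm (D x - S n) <= eps) ->
  cvgn S /\ D x @[x --> F] --> (limn S : R[i]^o).
Proof.
move=> DS.
have cvgS : cvgn S.
  apply: complex_cauchy_cvgn => eps eps0.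
  have eps20 : 0 < eps / 2 by rewrite divr_gt0.
  have [N _ DN] := DS _ eps20.
  exists N => n Nn.
  have [x [Dn DNx]] := filter_ex (filterI (DN n Nn) (DN N (leqnn N))).
  rewrite [eps]splitr -(subrKA (D x)) (le_trans (ler_rnormD _ _)) // lerD //.
  by rewrite -rnormN opprB.
split=> //; apply/cvg_rnormP => eps eps0.
have eps20 : 0 < eps / 2 by rewrite divr_gt0.
have /cvg_rnormP /(_ _ eps20) Sl := cvgS.
have [n [Dn Sn]] := filter_ex (filterI (DS _ eps20) Sl).
near=> x; rewrite [eps]splitr -(subrKA (S n)) (le_trans (ler_rnormD _ _)) //.
rewrite lerD //; near: x; exact: Dn.
Unshelve. all: by end_near. Qed.

(** The limsup is an infimum, over the sets of [F], of suprema; if it is below [eps], already one of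
    these suprema is. *)
Lemma limf_esup_lt_near (T : choiceType) (X : filteredType T)
    (F : set_system X) (FF : Filter F)
    (f : X -> R) (eps : R) :
  (limf_esup (fun x => (f x)%:E) F < eps%:E)%E ->
  \forall x \near F, f x <= eps.
Proof.
move=> /ereal_inf_lt [_ [V FV <-] supV]; apply: filterS FV => x Vx.
rewrite -lee_fin; apply: le_trans (ltW supV).
by apply: ereal_sup_ubound; exists x.
Qed.

Lemma continuous_linear_rnorm_le V (f : {linear V -> R[i]^o}) :
  continuous f -> exists M : R, 0 <= M /\ forall x, rnorm (f x) <= M * rnorm x.
Proof.
move=> /linear_bounded_continuous /linear_boundedP /pinfty_ex_gt0 [M M0 fM].
have ME : M = (complex.Re M)%:C by rewrite RRe_real // gtr0_real.
exists (complex.Re M); split; first by rewrite -lecR -ME ltW.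
by move=> x; rewrite -lecR rmorphM /= -ME !rnormE.
Qed.

(** The bound [M] ensures that the set defining [dual_norm f] is bounded above, so that [sup] is a
    genuine supremum; then rescale [x] to norm one. *)
Lemma le_dual_norm V (f : {linear V -> R[i]^o}) (M : R) :
  (forall x, rnorm (f x) <= M * rnorm x) ->
  forall x, rnorm (f x) <= dual_norm f * rnorm x.
Proof.
move=> fM x; have [/rnorm0_eq0 ->|x_neq0] := eqVneq (rnorm x) 0.
  by rewrite linear0 !rnorm0 mulr0.
have x_gt0 : 0 < rnorm x by rewrite lt_neqAle eq_sym x_neq0 rnorm_ge0.
have xV0 : 0 <= (rnorm x)^-1 by rewrite invr_ge0 ltW.
have -> : rnorm (f x) = rnorm (f ((rnorm x)^-1%:C *: x)) * rnorm x.
  by rewrite linearZ /= rnormM rnorm_real // mulrAC mulVf // mul1r.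
rewrite ler_wpM2r ?rnorm_ge0 //; apply: ub_le_sup; last first.
  exists ((rnorm x)^-1%:C *: x) => //=.
  by rewrite rnormZ rnorm_real // mulVf.
(* The sign of [M] is unknown, hence the absolute value. *)
exists `|M| => _ [y /= y1 <-].
rewrite (le_trans (fM y)) // (le_trans (ler_norm _)) // normrM.
by rewrite [`|rnorm y|]ger0_norm ?rnorm_ge0 // ler_piMr.
Qed.

Lemma dual_norm_ge0 V (f : V -> R[i]^o) : 0 <= dual_norm f.
Proof.
rewrite /dual_norm; set E := [set _ | _ in _].
(* When there is no supremum, [sup] takes its default value 0. *)
have [supE|/sup_out -> //] := pselect (has_sup E).
have [x Ex] := supE.1; apply: le_trans (ub_le_sup supE.2 Ex).
by have [y _ <-] := Ex; exact: rnorm_ge0.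
Qed.

End ComplexNorm.

(** * Transport between equal fibres, and linearity of the iterates *)

Section Transport.
Variables (R : realType) (Omega : Type) (sigma tau : Omega -> Omega).
Variable B : Omega -> normedModType R[i].

Lemma transport_irr (w w' : Omega) (E E' : w = w') (x : B w) :
  transport E x = transport E' x.
Proof. by rewrite (Prop_irrelevance E E'). Qed.

Lemma transport_trans (u v w : Omega) (E : u = v) (E' : v = w) (x : B u) :
  transport E' (transport E x) = transport (etrans E E') x.
Proof. by case: w / E'; case: v / E. Qed.

Lemma transport_fun (s : forall w, B w) (w w' : Omega) (E : w = w') :
  transport E (s w) = s w'.
Proof. by case: w' / E. Qed.

Lemma transport_is_linear (w w' : Omega) (E : w = w') :
  linear (transport E : B w -> B w').
Proof. by case: w' / E. Qed.

HB.instance Definition _ (w w' : Omega) (E : w = w') :=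
  GRing.isLinear.Build R[i] (B w) (B w') *:%R (transport E)
    (transport_is_linear E).

Lemma transport_iter_op (A : forall w, B w -> B (sigma w)) (n : nat)
    (u v : Omega) (E : u = v) (E' : iter n sigma u = iter n sigma v) (x : B u) :
  transport E' (iter_op A n x) = iter_op A n (transport E x).
Proof.
by case: v / E E' => E'; rewrite (transport_irr E' (erefl _)).
Qed.

Lemma transport_op (A : forall w, B w -> B (sigma w))
    (u v : Omega) (E : u = v) (E' : sigma u = sigma v) (x : B u) :
  transport E' (A u x) = A v (transport E x).
Proof. exact: (transport_iter_op A (n := 1)). Qed.

(** [iter_op] peels off the last operator, whereas the telescoping sum needs the first one; the two
    base points agree only propositionally, hence the transport. *)
Lemma iter_op_Sr (A : forall w, B w -> B (sigma w)) (n : nat) (u : Omega)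
    (E : iter n.+1 sigma u = iter n sigma (sigma u)) (x : B u) :
  transport E (iter_op A n.+1 x) = iter_op A n (A u x).
Proof.
elim: n E => [|n IHn] E; first by rewrite (transport_irr E (erefl _)).
rewrite [RHS]/= -(IHn (iterSr n sigma u)).
exact: transport_op.
Qed.

Variable tK : cancel tau sigma.

Lemma pull_op_Sr (A : forall w, B w -> B (sigma w)) (n : nat) (w : Omega)
    (x : B (iter n.+1 tau w)) :
  pull_op tK A x = pull_op tK A (transport (tK (iter n tau w)) (A _ x)).
Proof.
rewrite /pull_op.
rewrite -(transport_iter_op A (tK (iter n tau w))
  (congr1 (iter n sigma) (tK (iter n tau w)))).
rewrite -(iter_op_Sr A (iterSr n sigma (iter n.+1 tau w))) !transport_trans.
exact: transport_irr.
Qed.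

Lemma iter_op_is_linear (A : forall w, {linear B w -> B (sigma w)}) (n : nat)
    (w : Omega) :
  linear (@iter_op R Omega sigma B (fun u => A u) n w).
Proof. by elim: n => [|n IHn] a x y //=; rewrite IHn linearP. Qed.

Lemma pull_op_is_linear (A : forall w, {linear B w -> B (sigma w)}) (n : nat)
    (w : Omega) :
  linear (@pull_op R Omega sigma tau B tK (fun u => A u) n w).
Proof. by move=> a x y; rewrite /pull_op iter_op_is_linear linearP. Qed.

HB.instance Definition _ (A : forall w, {linear B w -> B (sigma w)}) (n : nat)
    (w : Omega) :=
  GRing.isLinear.Build R[i] (B (iter n tau w)) (B w) *:%R
    (@pull_op R Omega sigma tau B tK (fun u => A u) n w)
    (pull_op_is_linear A (n := n) (w := w)).

Lemma lambda_iter_S (lambda : Omega -> R -> R[i]) (n : nat) (w : Omega) e :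
  lambda_iter sigma lambda n.+1 (iter n.+1 tau w) e =
  lambda (iter n.+1 tau w) e * lambda_iter sigma lambda n (iter n tau w) e.
Proof.
rewrite /lambda_iter big_ord_recl; congr (_ * _).
by apply: eq_bigr => i _; rewrite lift0 iterSr iterS tK.
Qed.

Variable L : forall w, R -> {linear B w -> B (sigma w)}.

Lemma Ldiff_is_linear w e : linear (@Ldiff R Omega sigma B L w e).
Proof.
by move=> a x y; rewrite /Ldiff !linearP addrACA -scalerDr.
Qed.

HB.instance Definition _ w e :=
  GRing.isLinear.Build R[i] (B w) (B (sigma w)) *:%R (@Ldiff R Omega sigma B L w e)
    (Ldiff_is_linear e).

End Transport.

(** * Eigenvalue differences and the two expressions for the rescaled iterates *)

Section Expansion.
Variables (R : realType) (Omega : Type) (sigma tau : Omega -> Omega).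
Variable tK : cancel tau sigma.
Variable B : Omega -> normedModType R[i].
Variable ebar : R.
Hypothesis ebar_gt0 : 0 < ebar.
Variable L : forall w, R -> {linear B w -> B (sigma w)}.
Variable nu : forall w, R -> {linear B w -> R[i]^o}.
Variable lambda : Omega -> R -> R[i].
Variable phi : forall w, R -> B w.
Variable Q : forall w, R -> {linear B w -> B (sigma w)}.
Hypothesis h1 : P1 ebar L.
Hypothesis h2 : P2 ebar L nu lambda phi.
Hypothesis h3 : P3 ebar L nu lambda phi Q.
Hypothesis h4 : P4 ebar phi.

Let parameter0 : 0 <= (0 : R) <= ebar.
Proof. by rewrite lexx ltW. Qed.

Lemma lambda_neq0 w e : 0 <= e <= ebar -> lambda w e != 0.
Proof. by case/(h2 w). Qed.

Lemma lambda_iter_neq0 n w e :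
  0 <= e <= ebar -> lambda_iter sigma lambda n w e != 0.
Proof. by move=> e_in; apply/prodf_neq0 => i _; exact: lambda_neq0. Qed.

Lemma op_phi w e : 0 <= e <= ebar ->
  L w e (phi w e) = lambda w e *: phi (sigma w) e.
Proof. by case/(h2 w). Qed.

(** Apply the functional at parameter 0 to both operators: its equivariance handles [L w 0], the
    eigenvector relation handles [L w e], and the normalisation in [P2] is used once on each
    fibre. *)
Lemma lambda_sub w e : 0 <= e <= ebar ->
  lambda w 0 - lambda w e = nu (sigma w) 0 (Ldiff L e (phi w e)).
Proof.
move=> e_in; have [_ _ Lphi _ nuphi] := h2 w e_in.
have [_ _ _ nuL _] := h2 w parameter0.
have [_ _ _ _ nuphiS] := h2 (sigma w) e_in.
rewrite /Ldiff linearB /= nuL nuphi mulr1 Lphi linearZ /= nuphiS.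
by congr (_ - _); rewrite -[LHS]mulr1.
Qed.

Lemma op_rnorm_le w : exists M : R, 0 <= M /\
  forall e, 0 <= e <= ebar -> forall f : B w, rnorm (L w e f) <= M * rnorm f.
Proof.
have [C1 C1P] := h1; exists (C1 w); have [C1_ge0 C1L] := C1P w.
split=> // e e_in f; rewrite -lee_fin; apply: le_trans (C1L f).
by apply: ereal_sup_ubound; exists e => //=; rewrite in_itv.
Qed.

(** Continuity of the functional and the bound on the operators from [P1] make the composite
    bounded, so its dual norm is not a default value. *)
Lemma eta_bound w e : 0 <= e <= ebar -> forall x,
  rnorm (nu (sigma w) 0 (Ldiff L e x)) <= Defs.eta L nu w e * rnorm x.
Proof.
move=> e_in.
have [nu_cont _ _ _ _] := h2 (sigma w) parameter0.
have [M [M_ge0 nuM]] := continuous_linear_rnorm_le nu_cont.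
have [C [C_ge0 LC]] := op_rnorm_le w.
apply: (@le_dual_norm _ _ (nu (sigma w) 0 \o @Ldiff _ _ _ _ L w e)
  (M * (C + C))) => x /=.
rewrite (le_trans (nuM _)) // -mulrA ler_wpM2l //.
by rewrite (le_trans (ler_rnormB _ _)) // mulrDl lerD // LC.
Qed.

Lemma lambda_sub_le w : exists C : R, forall e, 0 <= e <= ebar ->
  rnorm (lambda w 0 - lambda w e : R[i]^o) <= Defs.eta L nu w e * C.
Proof.
have [C2 C2P] := h4; exists (C2 w) => e e_in; rewrite lambda_sub //.
have [_ C2E] := C2P w.
rewrite (le_trans (eta_bound e_in _)) // ler_wpM2l //.
  exact: dual_norm_ge0.
rewrite -lee_fin -C2E.
by apply: ereal_sup_ubound; exists e => //=; rewrite in_itv.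
Qed.

Lemma near_parameter : \forall e \near (0 : R)^'+, 0 < e <= ebar.
Proof.
near=> e; apply/andP; split; near: e.
  exact: nbhs_right_gt.
exact: nbhs_right_le.
Unshelve. all: by end_near. Qed.

(** The range of [Q] lies in the kernel of the functional, so on it [L] acts as [lambda] times [Q],
    while the [phi] component is only rescaled. The exponent is [n.+1] because at exponent 0 the
    formula would carry a spurious [phi] term. *)
Lemma iter_op_expansion n u e (x : B u) : 0 <= e <= ebar ->
  iter_op (fun v => L v e) n.+1 x = lambda_iter sigma lambda n.+1 u e *:
    (nu u e x *: phi (iter n.+1 sigma u) e + iter_op (fun v => Q v e) n.+1 x).
Proof.
move=> e_in.
have LE v (y : B v) :
    L v e y = lambda v e *: (nu v e y *: phi (sigma v) e + Q v e y).
  have [<- _ _] := h3 v e_in.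
  by rewrite scalerA mulfV ?scale1r // lambda_neq0.
elim: n => [|n IHn].
  by rewrite /lambda_iter big_ord_recl big_ord0 mulr1 /= LE.
have nuQ : nu (iter n.+1 sigma u) e (iter_op (fun v => Q v e) n.+1 x) = 0.
  by have [_ _ ->] := h3 (iter n sigma u) e_in.
rewrite [LHS]/= -/(iter_op (fun v => L v e) n.+1 x) IHn.
rewrite [in RHS]/lambda_iter big_ord_recr -/(lambda_iter sigma lambda n.+1 u e).
rewrite -scalerA linearZ linearD linearZ /=.
congr (_ *: _).
rewrite op_phi // [L _ e (Q _ _ _)]LE nuQ scale0r add0r scalerDr.
by rewrite !scalerA mulrC.
Qed.

Lemma pull_op_expansion n w e (x : B (iter n.+1 tau w)) : 0 <= e <= ebar ->
  pull_op tK (fun v => L v e) x =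
    lambda_iter sigma lambda n.+1 (iter n.+1 tau w) e *:
    (nu (iter n.+1 tau w) e x *: phi w e + pull_op tK (fun v => Q v e) x).
Proof.
move=> e_in; rewrite /pull_op iter_op_expansion // linearZ linearD linearZ /=.
by rewrite (transport_fun (fun v => phi v e)).
Qed.

(* This is N_n of the header. *)
Definition rescaled_ratio w n e : R[i] :=
  (lambda_iter sigma lambda n (iter n tau w) 0)^-1 *
  nu (sigma w) 0 (Ldiff L e
    (pull_op tK (fun u => L u e) (phi (iter n tau w) 0))) / Delta L nu phi w e.

Lemma rescaled_ratioS w n e :
  rescaled_ratio w n.+1 e = rescaled_ratio w n e -
  (lambda_iter sigma lambda n.+1 (iter n.+1 tau w) 0)^-1 *
    q_ratio tK L nu phi w n e.
Proof.
set u := iter n tau w.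
(* The innermost operator is written as [L] at 0 minus [Ldiff]; the unperturbed one acts on its
   eigenvector [phi] by a scalar. *)
have pull_Sr : pull_op tK (fun u => L u e) (phi (iter n.+1 tau w) 0) =
    lambda (iter n.+1 tau w) 0 *: pull_op tK (fun u => L u e) (phi u 0)
    - pull_op tK (fun u => L u e)
        (transport (tK u) (Ldiff L e (phi (iter n.+1 tau w) 0))).
  rewrite pull_op_Sr -linearZ -linearB; congr (pull_op _ _ _).
  rewrite /Ldiff linearB /= op_phi // linearZ /=.
  by rewrite (transport_fun (fun v => phi v 0)) opprB addrC subrK.
rewrite /rescaled_ratio pull_Sr (linearB (@Ldiff _ _ _ _ L w e)) linearB.
rewrite (linearZZ (@Ldiff _ _ _ _ L w e)) linearZ /= /q_ratio -/u.
rewrite !mulrA -mulrBl mulrBr; congr ((_ - _) / _).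
rewrite lambda_iter_S // invfM -/u !mulrA [_ / _ * lambda _ _]mulrAC.
by rewrite mulVf ?mul1r // lambda_neq0.
Qed.

Lemma rescaled_ratioE w n e : Delta L nu phi w e != 0 ->
  rescaled_ratio w n e = 1 - \sum_(0 <= k < n)
    (lambda_iter sigma lambda k.+1 (iter k.+1 tau w) 0)^-1 *
      q_ratio tK L nu phi w k e.
Proof.
move=> Delta0; elim: n => [|n IHn].
  (* With no iterate the ratio is [Delta] over itself, so it is 1 because [Delta] is nonzero. *)
  rewrite big_nil subr0 /rescaled_ratio /lambda_iter big_ord0 invr1 mul1r.
  by rewrite /pull_op (transport_irr _ (erefl _)) /= divff.
by rewrite rescaled_ratioS IHn big_nat_recr //= opprD addrA.
Qed.

(** In the spectral expansion, [lambda_sub] turns the [phi w e] component into the eigenvalue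
    difference. *)
Lemma rescaled_ratio_expansion w n e : 0 <= e <= ebar ->
  rescaled_ratio w n.+1 e =
  (lambda_iter sigma lambda n.+1 (iter n.+1 tau w) 0)^-1 *
  lambda_iter sigma lambda n.+1 (iter n.+1 tau w) e *
  (nu (iter n.+1 tau w) e (phi (iter n.+1 tau w) 0) *
     ((lambda w 0 - lambda w e) / Delta L nu phi w e) +
   (Delta L nu phi w e)^-1 * nu (sigma w) 0 (Ldiff L e
     (pull_op tK (fun u => Q u e) (phi (iter n.+1 tau w) 0)))).
Proof.
move=> e_in; rewrite /rescaled_ratio pull_op_expansion // lambda_sub //.
rewrite (linearZZ (@Ldiff _ _ _ _ L w e)) (linearD (@Ldiff _ _ _ _ L w e)).
rewrite (linearZZ (@Ldiff _ _ _ _ L w e)) linearZ linearD linearZ /=.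
rewrite -!mulrA; congr (_ * (_ * _)).
by rewrite mulrDl mulrA [X in _ + X]mulrC.
Qed.

(** * Continuity of the eigenvalues at parameter 0 *)

Hypothesis h5 : P5 L nu.

Lemma cvg_lambda w :
  (lambda w e : R[i]^o) @[e --> 0^'+] --> (lambda w 0 : R[i]^o).
Proof.
have [C lambdaC] := lambda_sub_le w; apply/cvg_rnormP => eps eps0.
have /cvgr0_norm_le /(_ _ eps0) etaC : Defs.eta L nu w e * C @[e --> 0^'+] --> 0.
  by rewrite -[X in _ --> X](mul0r C); exact: cvgM (h5 w) (cvg_cst C).
near=> e; rewrite -rnormN opprB; have e_in : 0 <= e <= ebar.
  by have /andP[/ltW -> ->] : 0 < e <= ebar by near: e; exact: near_parameter.
apply: le_trans (lambdaC e e_in) _; apply: le_trans (ler_norm _) _.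
by near: e.
Unshelve. all: by end_near. Qed.

Lemma cvg_lambda_iter n w :
  (lambda_iter sigma lambda n w e : R[i]^o) @[e --> 0^'+] -->
    (lambda_iter sigma lambda n w 0 : R[i]^o).
Proof.
elim: n => [|n IHn].
  rewrite /lambda_iter big_ord0; under eq_fun do rewrite big_ord0.
  exact: cvg_cst.
rewrite /lambda_iter big_ord_recr /=.
under eq_fun do rewrite big_ord_recr /=.
by apply: cvgM; [exact: IHn | exact: cvg_lambda].
Qed.

End Expansion.

(** Solving for [D] gives [D - S = (v^-1 * (r^-1 * N) - S) - v^-1 * E]. The first part tends to 0
    and is eventually at most [eps / 2]; the inverse of [v] is eventually at most 2 in modulus, so
    [E] may be as large as [eps / 4]. *)
Lemma near_rnorm_sub_le (R : realType) (T : Type) (F : set_system T)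
    (FF : Filter F) (D N r v E : T -> R[i]^o) (S : R[i]^o) (eps : R) :
  0 < eps ->
  (\forall x \near F, N x = r x * (v x * D x + E x)) ->
  r x @[x --> F] --> (1 : R[i]^o) -> v x @[x --> F] --> (1 : R[i]^o) ->
  N x @[x --> F] --> S ->
  (\forall x \near F, rnorm (E x) <= eps / 4) ->
  \forall x \near F, rnorm (D x - S) <= eps.
Proof.
move=> eps0 NE r1 v1 NS Eeps.
have one_neq0 : (1 : R[i]^o) != 0 by exact: oner_neq0.
have vV : (v x)^-1 @[x --> F] --> (1 : R[i]^o).
  by rewrite -[X in _ --> X]invr1; exact: cvgV v1.
have rV : (r x)^-1 @[x --> F] --> (1 : R[i]^o).
  by rewrite -[X in _ --> X]invr1; exact: cvgV r1.
have cNS : (v x)^-1 * ((r x)^-1 * N x) @[x --> F] --> S.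
  have rNS : (r x)^-1 * N x @[x --> F] --> (1 * S : R[i]^o) by exact: cvgM rV NS.
  have vrNS : (v x)^-1 * ((r x)^-1 * N x) @[x --> F] --> (1 * (1 * S) : R[i]^o).
    exact: cvgM vV rNS.
  by rewrite (mul1r S) (mul1r S) in vrNS.
have neq0 (f : T -> R[i]^o) : f x @[x --> F] --> (1 : R[i]^o) ->
    \forall x \near F, f x != 0.
  (* A value within 1/2 of 1 cannot vanish. *)
  move=> /cvg_rnormP /(_ 2^-1); rewrite invr_gt0 ltr0n => /(_ isT).
  apply: filterS => x; apply: contraTneq => ->.
  by rewrite sub0r rnormN rnorm_real // -ltNge invf_lt1 // ltr1n.
have eps20 : 0 < eps / 2 by rewrite divr_gt0.
have vV_le2 : \forall x \near F, rnorm ((v x)^-1 : R[i]^o) <= 2.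
  move/cvg_rnormP: vV => /(_ 1 ltr01); apply: filterS => x vx.
  rewrite -(subrK (1 : R[i]^o) (v x)^-1) (le_trans (ler_rnormD _ _)) //.
  by rewrite [leRHS](_ : 2 = 1 + 1) // lerD // rnorm_real.
move/cvg_rnormP: cNS => /(_ _ eps20) cNS.
near=> x.
have rx0 : r x != 0 by near: x; exact: neq0.
have vx0 : v x != 0 by near: x; exact: neq0.
have -> : D x - S = ((v x)^-1 * ((r x)^-1 * N x) - S) - (v x)^-1 * E x.
  rewrite (near NE x _) // mulKf // mulrDr mulKf //.
  by rewrite addrAC addrK.
rewrite (le_trans (ler_rnormB _ _)) // [leRHS]splitr lerD //.
  by near: x.
have -> : eps / 2 = 2 * (eps / 4) by lra.
rewrite rnormM ler_pM ?rnorm_ge0 //; near: x; [exact: vV_le2|exact: Eeps].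
Unshelve. all: by end_near. Qed.

Theorem theoremA (R : realType) (Omega : Type) (sigma tau : Omega -> Omega)
  (sK : cancel sigma tau) (tK : cancel tau sigma)
  (B : Omega -> normedModType R[i])
  (ebar : R) (ebar_gt0 : 0 < ebar)
  (L : forall w, R -> {linear B w -> B (sigma w)})
  (nu : forall w, R -> {linear B w -> R[i]^o})
  (lambda : Omega -> R -> R[i])
  (phi : forall w, R -> B w)
  (Q : forall w, R -> {linear B w -> B (sigma w)})
  (h1 : P1 ebar L)
  (h2 : P2 ebar L nu lambda phi)
  (h3 : P3 ebar L nu lambda phi Q)
  (h4 : P4 ebar phi)
  (h5 : P5 L nu)
  (h6 : P6 ebar L nu phi)
  (h7 : P7 nu phi)
  (h8 : P8 tK ebar L nu phi Q)
  (w : Omega) :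
  (forall e0 : R, 0 < e0 ->
     (forall e : R, 0 <= e <= ebar -> e <= e0 -> Delta L nu phi w e = 0) ->
     forall e : R, 0 <= e <= ebar -> e <= e0 -> lambda w 0 = lambda w e)
  /\
  (Delta_pos ebar L nu phi w -> P9 tK ebar L nu phi ->
     let a : R[i]^o^nat := fun k =>
       (lambda_iter sigma lambda k.+1 (iter k.+1 tau w) 0)^-1
       * q tK L nu phi w k in
     cvgn (series a) /\
     (lambda w 0 - lambda w e) / Delta L nu phi w e @[e --> 0^'+]
       --> (1 - limn (series a) : R[i]^o)).
Proof.
have param0 : 0 <= (0 : R) <= ebar by rewrite lexx ltW.
split=> [e0 e0_gt0 Delta0 e e_in e_le|Delta_gt0 h9 a].
  (* For (a), the second half of [P6] makes [eta] vanish, and the bound on the eigenvalue difference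
     with it. *)
  have [C lambdaC] := lambda_sub_le ebar_gt0 h1 h2 h4 w.
  have := lambdaC e e_in; rewrite (h6.2 w e0 e0_gt0 Delta0 e e_in e_le) mul0r.
  move=> le0; apply/subr0_eq/(@rnorm0_eq0 R R[i]^o)/le_anti.
  by rewrite le0 rnorm_ge0.
pose D e : R[i]^o := (lambda w 0 - lambda w e) / Delta L nu phi w e.
suff DS : forall eps : R, 0 < eps -> \forall n \near \oo,
    \forall e \near 0^'+, rnorm (D e - (1 - series a n)) <= eps.
  have [cvgS D_lim] := cvg_uniform_approx _ DS.
  set S := (fun n => _ : R[i]^o) in cvgS D_lim.
  have cvgSB : (1 : R[i]^o) - S n @[n --> \oo] --> ((1 : R[i]^o) - limn S).
    exact: cvgB (cvg_cst _) cvgS.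
  (* The convergence obtained is that of [1 - series a]; it is reflected back to the series
     itself. *)
  have aE : (fun n => (1 : R[i]^o) - S n) = series a.
    by apply/funext => n; rewrite /S opprB addrC subrK.
  rewrite aE in cvgSB; split; first by apply/cvg_ex; exists (1 - limn S).
  have -> : limn (series a) = (1 : R[i]^o) - limn S.
    by apply: cvg_lim; [exact: norm_hausdorff|exact: cvgSB].
  rewrite opprB addrC subrK; exact: D_lim.
move=> eps eps0.
pose u n := iter n tau w.
pose E n e : R[i]^o := (Delta L nu phi w e)^-1 * nu (sigma w) 0 (Ldiff L e
     (pull_op tK (fun u => Q u e) (phi (u n) 0))).
have E_small : \forall n \near \oo, \forall e \near 0^'+,
    rnorm (E n e) <= eps / 4.
  have eps4 : 0 < eps / 4 by rewrite divr_gt0.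
  (* The limit in [P8] is taken in the extended reals: the limsup is finite for large [n], and its
     real values tend to 0. *)
  have [fin /cvgr0_norm_lt /(_ _ eps4) lt4] := (fine_cvgP _ _).1 (h8 w Delta_gt0).
  near=> n; apply: limf_esup_lt_near.
  rewrite -[ltLHS]fineK; last by near: n; exact: fin.
  rewrite lte_fin; apply: le_lt_trans (ler_norm _) _; near: n; exact: lt4.
(* The index 0 is left out because the spectral expansion needs at least one iterate. *)
suff step n : (0 < n)%N -> (\forall e \near 0^'+, rnorm (E n e) <= eps / 4) ->
    \forall e \near 0^'+, rnorm (D e - (1 - series a n)) <= eps.
  by near=> n; apply: step; near: n; [exact: nbhs_infty_gt|exact: E_small].
case: n => [//|m] _ Em.
refine (@near_rnorm_sub_le R R 0^'+ _ D (rescaled_ratio tK L nu lambda phi w m.+1)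
  (fun e => (lambda_iter sigma lambda m.+1 (u m.+1) 0)^-1 *
            lambda_iter sigma lambda m.+1 (u m.+1) e)
  (fun e => nu (u m.+1) e (phi (u m.+1) 0)) (E m.+1) (1 - series a m.+1) eps
  eps0 _ _ _ _ Em).
- apply: filterS (near_parameter ebar_gt0) => e /andP[/ltW e_ge0 e_le].
  by apply: (rescaled_ratio_expansion tK ebar_gt0 h2 h3); rewrite e_ge0.
- rewrite -[X in _ --> X](mulVf (lambda_iter_neq0 h2 m.+1 (u m.+1) param0)).
  by apply: cvgM; [exact: cvg_cst|exact: (cvg_lambda_iter ebar_gt0 h1 h2 h4 h5)].
- exact: h7.
pose b k e : R[i]^o := (lambda_iter sigma lambda k.+1 (u k.+1) 0)^-1 *
      q_ratio tK L nu phi w k e.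
have sum_cvg k : \sum_(0 <= j < k) b j e @[e --> 0^'+] --> (series a k : R[i]^o).
  elim: k => [|k IHk].
    rewrite /series /= big_nil; under eq_fun do rewrite big_nil.
    exact: cvg_cst.
  rewrite seriesSr; under eq_fun do rewrite big_nat_recr //=.
  apply: cvgD IHk _; apply: cvgM; [exact: cvg_cst | exact: h9].
(* For fixed [m] the telescoped form is a finite sum, so its limit is taken term by term; it agrees
   with the ratio where [Delta] is positive, hence near 0 on the right. *)
apply: (@cvg_trans _ ((1 - \sum_(0 <= j < m.+1) b j e) @[e --> 0^'+])).
  apply: near_eq_cvg; apply: filterS (near_parameter ebar_gt0) => e e_in.
  by rewrite (rescaled_ratioE tK ebar_gt0 h2) // gt_eqF // Delta_gt0.
by apply: cvgB => //; exact: cvg_cst.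
Unshelve. all: by end_near. Qed.
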